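(* For all $k,l,n,m\in\mathbb{Z}^+$, every pretabular logic extending $\mathsf{S4BP}^{k,l}_{n,m}$ has the finite model property.
   Context: Tense formulas use $\Box$, $\Diamond=\neg\Box\neg$ and a past possibility operator written here $\mathsf{P}$; $\mathsf{S4}_t=\mathsf{K}_t\oplus\{\Box p\to p,\Box p\to\Box\Box p\}$. With $\Delta\phi=\phi\vee\Diamond\phi\vee\mathsf{P}\phi$, $\Delta^{j+1}\phi=\Delta\Delta^j\phi$: $\mathbf{bz}_l=\Delta^{l+1}p\to\Delta^lp$; $\mathbf{bw}^+_n=\bigwedge_{i\leq n}\Diamond p_i\to\bigvee_{i\neq j\leq n}\Diamond(p_i\wedge(p_j\vee\Diamond p_j))$; $\mathbf{bw}^-_m$ the same with $\mathsf{P}$ for $\Diamond$; $\mathbf{bd}_1=\Diamond\Box p_0\to p_0$, $\mathbf{bd}_{j+1}=\Diamond(\Box p_j\wedge\neg\mathbf{bd}_j)\to p_j$. $\mathsf{S4BP}^{k,l}_{n,m}=\mathsf{S4}_t\oplus\{\mathbf{bd}_k,\mathbf{bz}_l,\mathbf{bw}^+_n,\mathbf{bw}^-_m\}$. A logic is pretabular if it is not the logic of a finite frame but all its consistent proper extensions are; it has the finite model property if it is the logic of a class of finite frames. *)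

(* Defs.v *)
From mathcomp Require Import all_boot.
From mathcomp Require Import classical_sets.

Set Implicit Arguments.
Unset Strict Implicit.
Unset Printing Implicit Defensive.

Local Open Scope classical_set_scope.

(* [Past] is the past possibility operator, the converse of the diamond dual
   to [Box]. *)
Inductive form : Type :=
| Var of nat
| Bot
| Imp of form & form
| Box of form
| Past of form.

Definition Neg (a : form) : form := Imp a Bot.
Definition Top : form := Neg Bot.
Definition Or (a b : form) : form := Imp (Neg a) b.
Definition And (a b : form) : form := Neg (Imp a (Neg b)).
Definition Dia (a : form) : form := Neg (Box (Neg a)).

Fixpoint subst (s : nat -> form) (a : form) : form :=
  match a with
  | Var x => s x
  | Bot => Bot
  | Imp a b => Imp (subst s a) (subst s b)
  | Box a => Box (subst s a)
  | Past a => Past (subst s a)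
  end.

(* Variables and formulas [Box a], [Past a] are treated as propositional
   atoms, so that [tautology] consists of all substitution instances of
   classical propositional tautologies. *)
Fixpoint bool_eval (v : form -> bool) (a : form) : bool :=
  match a with
  | Bot => false
  | Imp a b => bool_eval v a ==> bool_eval v b
  | _ => v a
  end.

Definition tautology : set form := [set a | forall v, bool_eval v a].

(* With [Past] rather than its dual as a primitive, the adjunction rule replaces
   the usual presentation of K_t by necessitation and the axioms K and
   p -> Box (Past p), p -> ~ Past ~ (Dia p): together with tautologies and
   modus ponens it makes all of these derivable. *)
Record tense_logic (L : set form) : Prop := TenseLogic {
  tl_taut : tautology `<=` L;
  tl_mp : forall a b, L a -> L (Imp a b) -> L b;
  tl_subst : forall s a, L a -> L (subst s a);
  tl_adj : forall a b, L (Imp (Past a) b) <-> L (Imp a (Box b))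
}.

Definition oplus (L Sigma : set form) : set form :=
  smallest tense_logic (L `|` Sigma).

Definition Kt : set form := smallest tense_logic set0.

Definition S4t : set form :=
  oplus Kt [set Imp (Box (Var 0)) (Var 0);
                Imp (Box (Var 0)) (Box (Box (Var 0)))].

Definition Delta (a : form) : form := Or a (Or (Dia a) (Past a)).

Definition bz (l : nat) : form :=
  Imp (iter l.+1 Delta (Var 0)) (iter l Delta (Var 0)).

(* Indices i, j <= n range over 0, ..., n, i.e. over n + 1 variables. *)
Definition bw (D : form -> form) (n : nat) : form :=
  Imp (\big[And/Top]_(i < n.+1) D (Var i))
      (\big[Or/Bot]_(i < n.+1) \big[Or/Bot]_(j < n.+1 | i != j)
         D (And (Var i) (Or (Var j) (D (Var j))))).

Definition bw_fut (n : nat) : form := bw Dia n.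
Definition bw_past (m : nat) : form := bw Past m.

(* [bd_succ j] is bd_(j+1). *)
Fixpoint bd_succ (j : nat) : form :=
  match j with
  | 0 => Imp (Dia (Box (Var 0))) (Var 0)
  | j'.+1 => Imp (Dia (And (Box (Var j)) (Neg (bd_succ j')))) (Var j)
  end.

(* Meaningful for 0 < k only. *)
Definition bd (k : nat) : form := bd_succ k.-1.

Definition S4BP (k l n m : nat) : set form :=
  oplus S4t [set bd k; bz l; bw_fut n; bw_past m].

Record fin_frame : Type := FinFrame {
  world :> finType;
  acc : rel world;
  world_gt0 : 0 < #|world|
}.

Fixpoint truth (F : fin_frame) (V : nat -> pred F) (a : form) (w : F) : bool :=
  match a with
  | Var x => V x w
  | Bot => false
  | Imp a b => truth V a w ==> truth V b w
  | Box a => [forall u : F, acc w u ==> truth V a u]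
  | Past a => [exists u : F, acc u w && truth V a u]
  end.

Definition Log (F : fin_frame) : set form :=
  [set a | forall (V : nat -> pred F) (w : F), truth V a w].

(* The logic of the empty class is the inconsistent logic. *)
Definition Log_class (C : fin_frame -> Prop) : set form :=
  [set a | forall F, C F -> Log F a].

Definition consistent (L : set form) : Prop := ~ L Bot.

Definition tabular (L : set form) : Prop := exists F : fin_frame, L = Log F.

Definition pretabular (L : set form) : Prop :=
  ~ tabular L /\
  (forall L' : set form,
     tense_logic L' -> L `<` L' -> consistent L' -> tabular L').

Definition fmp (L : set form) : Prop :=
  exists C : fin_frame -> Prop, L = Log_class C.

(* Main.v *)
(** Every logic [L] above [S4BP k l n m] has the finite model property, because
    [S4BP k l n m] is locally tabular. Given [a] outside [L], only finitely many
    variables matter, so consider the canonical model of [L] in those variables.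
    There [bd] bounds strict chains and [bw] bounds the antichains among the
    successors and among the predecessors of a point, while two points of one
    cluster that agree on the variables satisfy the same formulas and hence
    coincide, so clusters are finite too. Every point therefore has finitely many
    neighbours, and by [bz] its connected component is a ball of radius [l],
    hence finite. In that component every set is definable, so it is an
    [L]-frame. *)

Require Import Defs.
From mathcomp Require Import all_boot.
From mathcomp Require Import boolp classical_sets cardinality.

Set Implicit Arguments.
Unset Strict Implicit.
Unset Printing Implicit Defensive.

Local Open Scope classical_set_scope.

Ltac taut :=
  let v := fresh "v" in
  move=> v /=;
  repeat match goal with
  | |- context [bool_eval v ?a] => case: (bool_eval v a)
  | |- context [v ?a] => case: (v a)
  end; by [].

(** * Lindenbaum's lemma and the canonical model *)

Section Canonical.
Variable L : set form.
Hypothesis L_taut : tautology `<=` L.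
Hypothesis L_mp : forall a b, L a -> L (Imp a b) -> L b.
Hypothesis L_adj : forall a b, L (Imp (Past a) b) <-> L (Imp a (Box b)).

(** Closure under modus ponens but not under adjunction: this is local consequence over [L]. *)
Definition theory (T : set form) : Prop :=
  L `<=` T /\ forall a b, T a -> T (Imp a b) -> T b.

Definition max_theory (u : set form) : Prop :=
  [/\ theory u, ~ u Bot & forall a, u a \/ u (Neg a)].

Lemma theory_taut T a : theory T -> tautology a -> T a.
Proof. by move=> [LT _] /L_taut/LT. Qed.

(** This set is the theory generated by [T] and [a]; it replaces a deduction theorem. *)
Lemma theory_imp T a : theory T -> theory [set b | T (Imp a b)].
Proof.
move=> thT; have [LT mpT] := thT; split=> [b Lb|b c /= Tab Tabc].
  by apply: (mpT b); [exact: LT | apply: theory_taut => //; taut].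
by apply: (mpT _ _ Tabc); apply: (mpT _ _ Tab); apply: theory_taut => //; taut.
Qed.

Lemma lindenbaum T :
  theory T -> ~ T Bot -> exists2 u, max_theory u & T `<=` u.
Proof.
move=> thT TBot.
(* [set0] is admitted because Zorn's lemma also takes the union of the empty
   chain. *)
pose P (A : set form) := A = set0 \/ [/\ theory A, T `<=` A & ~ A Bot].
have [F FP totF|A [PA maxA]] := @Zorn_bigcup form P.
  have [[A0 FA0 [a0 A0a0]]|F0] := pselect (exists2 A, F A & A !=set0); last first.
    left; rewrite -subset0 => a [A FA Aa].
    by case: F0; exists A => //; exists a.
  have P1 A a : F A -> A a -> [/\ theory A, T `<=` A & ~ A Bot].
    by move=> /FP[->|].
  have [[LA0 _] TA0 _] := P1 _ _ FA0 A0a0.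
  right; split; first split=> [a /LA0 A0a|a b [A FA Aa] [B FB Bab]].
  - by exists A0.
  - have [[_ mpA] _ _] := P1 _ _ FA Aa; have [[_ mpB] _ _] := P1 _ _ FB Bab.
    have [AB|BA] := totF _ _ FA FB.
      by exists B => //; apply: mpB Bab; exact: AB.
    by exists A => //; apply: mpA (BA _ Bab).
  - by move=> a /TA0 A0a; exists A0.
  - by move=> [A FA ABot]; have [_ _] := P1 _ _ FA ABot.
have TL a : L a -> T a by have [+ _] := thT; apply.
have An0 : A <> set0.
  move=> A0; apply: (maxA T); last by right; split.
  have TTop : T Top by apply/TL/L_taut; taut.
  by rewrite A0; split=> [//|/(_ _ TTop)].
have [//|[thA TA ABot]] := PA; exists A => //; split=> // a.
have [Aa|nAa] := pselect (A a); [by left | right].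
(* With neither [a] nor [Neg a] in [A], adding [a] gives a strictly larger theory, consistent
   because [Neg a] is [Imp a Bot]. *)
apply: contrapT => nAna; apply: (maxA [set b | A (Imp a b)]).
  have [_ mpA] := thA; split=> [b Ab|/(_ a) h].
    by apply: (mpA _ _ Ab); apply: theory_taut => //; taut.
  by apply: nAa; apply: h; apply: (theory_taut thA); taut.
right; split; [exact: theory_imp | move=> b /TA Ab | exact: nAna].
have [_ mpA] := thA.
by apply: (mpA _ _ Ab); apply: theory_taut => //; taut.
Qed.

Section MaxTheory.
Variables (u : set form) (mu : max_theory u).

Lemma max_theoryL a : L a -> u a.
Proof. by case: mu => -[Lu _] _ _; exact: Lu. Qed.

Lemma max_theory_imp a b : u (Imp a b) <-> (u a -> u b).
Proof.
have [thu uBot um] := mu; have [_ mp] := thu; split=> [uab ua|uab].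
  exact: mp ua uab.
have [/uab ub|una] := um a.
  by apply: (mp _ _ ub); apply: theory_taut => //; taut.
by apply: (mp _ _ una); apply: theory_taut => //; taut.
Qed.

Lemma max_theory_neg a : u (Neg a) <-> ~ u a.
Proof. by have [_ uBot _] := mu; rewrite max_theory_imp; split=> h /h. Qed.

End MaxTheory.

Lemma L_trans a b c : L (Imp a b) -> L (Imp b c) -> L (Imp a c).
Proof. by move=> h1 h2; apply: L_mp h1 (L_mp h2 _); apply: L_taut; taut. Qed.

(** Covers [Box] and its past counterpart [Hist], so that one existence lemma serves both
    directions. *)
Definition normal (B : form -> form) : Prop :=
  (forall a, L a -> L (B a)) /\
  (forall a b, L (Imp (B (Imp a b)) (Imp (B a) (B b)))).

Lemma Box_mono a b : L (Imp a b) -> L (Imp (Box a) (Box b)).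
Proof.
by move=> ab; apply/L_adj; apply: L_trans ab; apply/L_adj/L_taut; taut.
Qed.

Lemma Past_mono a b : L (Imp a b) -> L (Imp (Past a) (Past b)).
Proof.
by move=> ab; apply/L_adj; apply: L_trans ab _; apply/L_adj/L_taut; taut.
Qed.

Lemma normal_Box : normal Box.
Proof.
split=> [a La|a b].
  have /L_mp : L Top by apply: L_taut; taut.
  by apply; apply/L_adj; apply: L_mp La _; apply: L_taut; taut.
(* By adjunction it suffices that [Past X] implies [b]; it implies [Imp a b] and [a] because [X]
   implies their boxes. *)
pose X := And (Box (Imp a b)) (Box a).
have h1 : L (Imp (Past X) (Imp a b)).
  by apply/L_adj/L_taut; rewrite /X; taut.
have h2 : L (Imp (Past X) a) by apply/L_adj/L_taut; rewrite /X; taut.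
have /L_adj h : L (Imp (Past X) b).
  by apply: L_mp h1 (L_mp h2 _); apply: L_taut; taut.
by apply: L_mp h _; apply: L_taut; rewrite /X; taut.
Qed.

Definition Hist (a : form) : form := Neg (Past (Neg a)).

Lemma normal_Hist : normal Hist.
Proof.
split=> [a La|a b].
  by apply/L_adj; apply: L_mp La _; apply: L_taut; taut.
(* The contrapositive of K: [Neg b] entails [Neg a] or [Neg (Imp a b)], and by adjunction each of
   these entails [Box X]. *)
pose X := Or (Past (Neg a)) (Past (Neg (Imp a b))).
have h c : L (Imp (Past c) X) -> L (Imp c (Box X)) by move/L_adj.
have h1 : L (Imp (Neg a) (Box X)) by apply/h/L_taut; rewrite /X; taut.
have h2 : L (Imp (Neg (Imp a b)) (Box X)) by apply/h/L_taut; rewrite /X; taut.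
have /L_adj h3 : L (Imp (Neg b) (Box X)).
  by apply: L_mp h1 (L_mp h2 _); apply: L_taut; taut.
by apply: L_mp h3 _; apply: L_taut; rewrite /X /Hist; taut.
Qed.

(** The formulas [b] with [B b] in [u] form a theory consistent with [Neg a], since otherwise
    normality would put [B a] in [u]. *)
Lemma max_theory_normal B u a : normal B -> max_theory u -> ~ u (B a) ->
  exists2 v, max_theory v & (forall b, u (B b) -> v b) /\ ~ v a.
Proof.
move=> [Bnec BK] mu nuBa.
have K b c : u (B (Imp b c)) -> u (B b) -> u (B c).
  by have /(max_theoryL mu) := BK b c; do 2!rewrite (max_theory_imp mu).
have thB : theory [set b | u (B b)].
  by split=> [b /Bnec|b c /= ub]; [exact: max_theoryL | move=> /K; exact].
have uB b c : L (Imp b c) -> u (B b) -> u (B c).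
  by move=> /Bnec/(max_theoryL mu)/K.
have [|v mv uv] := lindenbaum (theory_imp (Neg a) thB).
  by move=> /= h; apply: nuBa; apply: uB h; apply: L_taut; taut.
exists v => //; split=> [b ub|]; last first.
  by apply/(max_theory_neg mv)/uv/(uB Top); [apply: L_taut; taut|
    apply: (max_theoryL mu); apply: Bnec; apply: L_taut; taut].
by apply: uv => /=; apply: uB ub; apply: L_taut; taut.
Qed.

Definition canon : Type := {u : set form | max_theory u}.

Definition canon_sat (w : canon) : form -> Prop := sval w.

Definition canon_acc (u v : canon) : Prop :=
  forall a, canon_sat u (Box a) -> canon_sat v a.

(** Adjunction yields [Imp a (Box (Past a))] and [Imp (Past (Box a)) a], so one relation interprets
    both modalities. *)
Lemma canon_acc_past u v :
  canon_acc u v <-> forall a, canon_sat u a -> canon_sat v (Past a).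
Proof.
case: u v => [u mu] [v mv]; rewrite /canon_acc /canon_sat /=.
split=> [uv a ua|vu a uBa].
  have : L (Imp a (Box (Past a))) by apply/L_adj/L_taut; taut.
  by move/(max_theoryL mu)/(max_theory_imp mu)/(_ ua)/uv.
have /(max_theoryL mv)/(max_theory_imp mv) : L (Imp (Past (Box a)) a).
  by apply/L_adj/L_taut; taut.
by apply; exact: vu.
Qed.

Lemma canon_sat_box w a :
  canon_sat w (Box a) <-> forall v, canon_acc w v -> canon_sat v a.
Proof.
split=> [wa v|H]; first exact.
apply: contrapT => nwa.
have [v mv [wv nva]] := max_theory_normal normal_Box (svalP w) nwa.
exact: nva (H (exist _ v mv) wv).
Qed.

Lemma canon_sat_past w a :
  canon_sat w (Past a) <-> exists2 u, canon_acc u w & canon_sat u a.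
Proof.
split=> [wa|[u /canon_acc_past uw /uw //]].
have mw := svalP w.
have [|u mu [wu una]] :=
    @max_theory_normal Hist _ (Neg a) normal_Hist mw.
  move=> /(max_theory_neg mw); apply.
  move: wa; apply/(max_theory_imp mw)/(max_theoryL mw)/Past_mono.
  by apply: L_taut; taut.
exists (exist _ u mu); last first.
  by apply: contrapT => nua; apply: una; exact: (max_theory_neg mu a).2 nua.
apply/canon_acc_past => b; rewrite /canon_sat /= => ub.
apply: contrapT => nwb.
have /wu : sval w (Hist (Neg b)).
  apply/(max_theory_neg mw); apply: contra_not nwb.
  apply/(max_theory_imp mw)/(max_theoryL mw)/Past_mono.
  by apply: L_taut; taut.
by move=> /(max_theory_neg mu).
Qed.

Lemma canon_tight u v :
  ~ canon_acc u v -> exists2 a, canon_sat u (Box a) & ~ canon_sat v a.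
Proof. by move=> /existsNP[a /not_implyP[]]; exists a. Qed.

Lemma canon_differentiated u v :
  u <> v -> exists2 a, canon_sat u a & ~ canon_sat v a.
Proof.
case: u v => [u mu] [v mv]; rewrite /canon_sat /= => uv; apply: contrapT => h.
have sub a : u a -> v a by move=> ua; apply: contrapT => nva; apply: h; exists a.
apply: uv; apply: eq_exist; apply/seteqP; split=> // a va.
have [_ _ /(_ a)[//|/sub]] := mu.
by move=> /(max_theory_neg mv).
Qed.

End Canonical.

(** * Finiteness from finite clusters and bounded chains and antichains *)

Section Preorder.
Variables (W : Type) (R : W -> W -> Prop).

Definition cluster (x : W) : set W := [set y | R x y /\ R y x].

(* [chain j x] asserts a strictly ascending chain of [j.+1] points of [A]
   starting at [x]. *)
Fixpoint chain (A : set W) (j : nat) (x : W) : Prop :=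
  match j with
  | 0 => A x
  | i.+1 => A x /\ exists2 y, R x y /\ ~ R y x & chain A i y
  end.

Lemma sub_chain A B j x : A `<=` B -> chain A j x -> chain B j x.
Proof.
move=> AB; elim: j x => [x /AB //|j IH x /= [/AB Bx [y xy /IH yB]]].
by split=> //; exists y.
Qed.

Lemma chain_head A j x : chain A j x -> A x.
Proof. by case: j => [|j []]. Qed.

(** Here [j] counts points, whereas [chain j] has [j.+1] of them. *)
Definition antichain (A : set W) (j : nat) (f : nat -> W) : Prop :=
  (forall i, i < j -> A (f i)) /\
  (forall i i', i < j -> i' < j -> i != i' -> ~ R (f i) (f i')).

(** As [R] is symmetric on [A], a point of [A] outside the clusters of an antichain extends it; so
    before size [n] the clusters cover [A]. *)
Lemma finite_minimal (A : set W) n :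
  (forall x, finite_set (cluster x)) ->
  (forall f, ~ antichain A n f) ->
  (forall x y, A x -> A y -> R x y -> R y x) ->
  finite_set A.
Proof.
move=> fincl noanti Asym.
have [[x0 Ax0]|A0] := pselect (A !=set0); last first.
  rewrite (_ : A = set0) // -subset0 => x Ax.
  by apply: A0; exists x.
suff [//|[f /noanti]] : finite_set A \/ exists f, antichain A n f by [].
elim: {noanti} n => [|j [|[f [Af f_anti]]]]; first by right; exists (fun=> x0).
  by left.
pose B := \bigcup_(i in [set: 'I_j]) cluster (f i).
have finB : finite_set B by apply: bigcup_finite.
have [/sub_finite_set/(_ finB)|] := pselect (A `<=` B); first by left.
move=> /existsNP[x /not_implyP[Ax nBx]]; right.
have xf i : i < j -> ~ R x (f i) /\ ~ R (f i) x.
  move=> ij; split=> h; apply: nBx; exists (Ordinal ij) => //; split=> //.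
    by apply: Asym => //; exact: Af.
  by apply: Asym => //; exact: Af.
exists (fun i => if i == j then x else f i); split=> [i|i i'].
  by rewrite ltnS leq_eqVlt; case: eqP => //= _ /Af.
rewrite !ltnS (leq_eqVlt i) (leq_eqVlt i').
case: eqP => [->|_] /=; case: eqP => [->|_] //=; first by rewrite eqxx.
- by move=> _ /xf[].
- by move=> /xf[].
- exact: f_anti.
Qed.

(** Induction on [k]: the points with a strict predecessor in [A] start only shorter chains, and [R]
    is symmetric on the remaining, minimal points. *)
Lemma finite_no_chain_antichain (A : set W) k n :
  (forall x, finite_set (cluster x)) ->
  (forall x, ~ chain A k x) ->
  (forall f, ~ antichain A n f) ->
  finite_set A.
Proof.
move=> fincl; elim: k A => [|k IH] A nochain noanti.
  by rewrite (_ : A = set0) // -subset0 => x /nochain.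
pose Min := [set x | A x /\ forall y, A y -> R y x -> R x y].
pose A' := [set x | A x /\ exists2 y, A y & R y x /\ ~ R x y].
have MinA : Min `<=` A by move=> x [].
have A'A : A' `<=` A by move=> x [].
have noantiS B : B `<=` A -> forall f, ~ antichain B n f.
  move=> BA f [Bf f_anti]; apply: (noanti f); split=> // i ij.
  by apply: BA; exact: Bf.
have finMin : finite_set Min.
  apply: finite_minimal (noantiS _ MinA) _ => // x y [Ax _] [_ minx]; exact: minx.
have finA' : finite_set A'.
  apply: IH (noantiS _ A'A) => x xA'.
  have [_ [y Ay [yx nxy]]] := chain_head xA'.
  by apply: (nochain y); split=> //; exists x => //; exact: sub_chain xA'.
apply: (@sub_finite_set _ _ (Min `|` A')); last by rewrite finite_setU.
move=> x Ax; have [h|nh] := pselect (exists2 y, A y & R y x /\ ~ R x y).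
  by right.
left; split=> // y Ay yx; apply: contrapT => nxy; apply: nh.
by exists y.
Qed.

End Preorder.

(** * Tight and differentiated models: definability and the axioms *)

Section Model.
Variables (W : choiceType) (R : W -> W -> Prop) (sat : W -> form -> Prop).
Hypothesis sat_bot : forall w, ~ sat w Bot.
Hypothesis sat_imp : forall w a b, sat w (Imp a b) <-> (sat w a -> sat w b).
Hypothesis sat_box :
  forall w a, sat w (Box a) <-> forall v, R w v -> sat v a.
Hypothesis sat_past :
  forall w a, sat w (Past a) <-> exists2 v, R v w & sat v a.
Hypothesis tight :
  forall u v, ~ R u v -> exists2 a, sat u (Box a) & ~ sat v a.
Hypothesis differentiated :
  forall u v, u <> v -> exists2 a, sat u a & ~ sat v a.

Lemma sat_neg w a : sat w (Neg a) <-> ~ sat w a.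
Proof. by rewrite sat_imp; split=> h /h => [/sat_bot|]. Qed.

Lemma sat_top w : sat w Top.
Proof. exact/sat_neg/sat_bot. Qed.

Lemma sat_or w a b : sat w (Or a b) <-> sat w a \/ sat w b.
Proof.
rewrite sat_imp sat_neg; split=> [h|[//|//]].
by have [|/h] := pselect (sat w a); [left | right].
Qed.

Lemma sat_and w a b : sat w (And a b) <-> sat w a /\ sat w b.
Proof.
rewrite sat_neg sat_imp sat_neg; split=> [h|[wa wb] /(_ wa)//].
by split; apply: contrapT => h'; apply: h.
Qed.

Lemma sat_dia w a : sat w (Dia a) <-> exists2 v, R w v & sat v a.
Proof.
rewrite sat_neg sat_box; split=> [h|[v wv va] /(_ v wv)/sat_neg//].
apply: contrapT => nh; apply: h => v wv; apply/sat_neg => va.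
by apply: nh; exists v.
Qed.

Lemma sat_big_and w s (I : eqType) (r : seq I) (P : pred I) (F : I -> form) :
  sat w (subst s (\big[And/Top]_(i <- r | P i) F i)) <->
  forall i, i \in r -> P i -> sat w (subst s (F i)).
Proof.
elim: r => [|i r IH]; first by rewrite big_nil; split=> // _; exact: sat_top.
rewrite big_cons; case: ifPn => Pi.
  rewrite sat_and IH; split=> [[wi h] j|h].
    by rewrite inE => /predU1P[->//|/h].
  split; first by apply: h; rewrite ?mem_head.
  by move=> j jr; apply: h; rewrite inE jr orbT.
rewrite IH; split=> h j jr; last by apply: h; rewrite inE jr orbT.
by move: jr; rewrite inE => /predU1P[->|/h//]; rewrite (negPf Pi).
Qed.

Lemma sat_big_or w s (I : eqType) (r : seq I) (P : pred I) (F : I -> form) :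
  sat w (subst s (\big[Or/Bot]_(i <- r | P i) F i)) ->
  exists i, [/\ i \in r, P i & sat w (subst s (F i))].
Proof.
elim: r => [|i r IH]; first by rewrite big_nil => /sat_bot.
have IH' : sat w (subst s (\big[Or/Bot]_(j <- r | P j) F j)) ->
    exists j, [/\ j \in i :: r, P j & sat w (subst s (F j))].
  by move=> /IH[j [jr Pj wj]]; exists j; rewrite inE jr orbT.
rewrite big_cons; case: ifPn => // Pi /sat_or[wi|/IH' //].
by exists i; rewrite mem_head.
Qed.

Lemma separate_seq x (s : seq W) :
  x \notin s -> exists2 d, sat x d & forall y, y \in s -> ~ sat y d.
Proof.
elim: s => [_|y s IH]; first by exists Top; [exact: sat_top | by []].
rewrite inE negb_or => /andP[/eqP/differentiated[a xa nya] /IH[d xd sd]].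
exists (And a d); first exact/sat_and.
by move=> z; rewrite inE => /predU1P[->|/sd nzd] /sat_and[].
Qed.

(** A formula that is right on the tail is corrected at a new head by one that separates the head
    from the tail. *)
Lemma define_seq (P : W -> Prop) (s : seq W) :
  exists c, forall y, y \in s -> (sat y c <-> P y).
Proof.
elim: s => [|x s [c cP]]; first by exists Bot.
have [xs|/separate_seq[d xd sd]] := boolP (x \in s).
  by exists c => y; rewrite inE => /predU1P[->|]; exact: cP.
have [Px|nPx] := pselect (P x).
  exists (Or c d) => y; rewrite inE => /predU1P[->|ys].
    by split=> // _; apply/sat_or; right.
  by rewrite sat_or cP //; split=> [[//|/(sd _ ys)//]|]; left.
exists (And c (Neg d)) => y; rewrite inE => /predU1P[->|ys].
  by rewrite sat_and sat_neg; split=> // -[].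
by rewrite sat_and sat_neg cP //; split=> [[]//|Py]; split=> //; exact: sd.
Qed.

(* Valuations on a finite generated submodel are definable in it, so closure of
   [L] under substitution turns truth of [L] in the model into validity. *)
Lemma finite_generated_frame (L : set form) (C : set W) w0 :
  (forall a s w, L a -> sat w (subst s a)) ->
  finite_set C -> C w0 ->
  (forall x y, C x -> R x y \/ R y x -> C y) ->
  exists2 F, L `<=` Log F & forall a, Log F a -> sat w0 (subst Var a).
Proof.
move=> Lsat /finite_seqP[t ->] tw0 tclosed.
pose e (x y : seq_sub t) := `[< R (val x) (val y) >].
have tgt0 : 0 < #|{: seq_sub t}| by apply/card_gt0P; exists (SeqSub tw0).
pose F := FinFrame e tgt0.
(* Truth lemma for a valuation defined by [s]; closure of [t] in both directions handles [Box] and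
   [Past]. *)
have truthP (V : nat -> pred F) s : (forall i x, V i x <-> sat (val x) (s i)) ->
    forall a (x : F), truth V a x <-> sat (val x) (subst s a).
  move=> Vs; elim=> /=.
  - exact: Vs.
  - by move=> x; split=> [//|/sat_bot].
  - move=> a IHa b IHb x; rewrite sat_imp -IHa -IHb.
    by split=> [/implyP|h]; last apply/implyP.
  - move=> a IH x; rewrite sat_box; split=> [/forallP h y xy|h].
      have ty : y \in t by apply: tclosed (valP x) _; left.
      by apply/(IH (SeqSub ty))/(implyP (h (SeqSub ty)))/asboolP.
    by apply/forallP => y; apply/implyP => /asboolP xy; apply/IH/h.
  - move=> a IH x; rewrite sat_past; split=> [/existsP[y /andP[/asboolP yx ya]]|].
      by exists (val y) => //; exact/IH.
    move=> [y yx ya].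
    have ty : y \in t by apply: tclosed (valP x) _; right.
    apply/existsP; exists (SeqSub ty); apply/andP; split; first exact/asboolP.
    exact/IH.
exists F => [a La V x|a Fa].
  have defV i : exists c, forall y (ty : y \in t), sat y c <-> V i (SeqSub ty).
    have [c cP] := define_seq (fun y => exists ty : y \in t, V i (SeqSub ty)) t.
    exists c => y ty; rewrite cP //; split=> [[ty']|]; last by exists ty.
    by rewrite (bool_irrelevance ty' ty).
  have [s sP] := choice defV.
  apply/(truthP V s); last exact: Lsat.
  by move=> i [y ty]; apply: iff_sym; exact: sP.
apply/(truthP (fun i x => `[< sat (val x) (Var i) >]) Var _ a (SeqSub tw0)).
  by move=> i x; split=> /asboolP.
exact: Fa.
Qed.


Lemma finite_conj w (F : nat -> form) (P : pred nat) n :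
  (forall j, j < n -> P j -> sat w (F j)) ->
  exists2 p, sat w p & forall v, sat v p -> forall j, j < n -> P j -> sat v (F j).
Proof.
elim: n => [_|n IH wF]; first by exists Top; [exact: sat_top | by []].
have [j jn Pj|p wp pP] := IH; first by apply: wF Pj; exact: ltnW.
exists (And p (if P n then F n else Top)).
  by apply/sat_and; split=> //; case: ifP => Pn; [exact: wF | exact: sat_top].
move=> v /sat_and[vp vn] j; rewrite ltnS leq_eqVlt => /predU1P[-> Pn|].
  by rewrite Pn in vn.
exact: pP.
Qed.

(** An antichain of [n.+1] points seen from [w] refutes an instance of [bw D n]. The pair [D], [S]
    stands for [Dia] with [R] or [Past] with the converse of [R]. *)
Lemma bw_antichain (D : form -> form) (S : W -> W -> Prop) n w :
  (forall s a, subst s (D a) = D (subst s a)) ->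
  (forall u a, sat u (D a) <-> exists2 v, S u v & sat v a) ->
  (forall u v, ~ S u v -> exists2 a, sat v a & ~ sat u (D a)) ->
  (forall u, S u u) ->
  (forall s, sat w (subst s (bw D n))) ->
  forall f, ~ antichain S [set v | S w v] n.+1 f.
Proof.
move=> substD satD sepD S_refl wbw f [wf f_anti].
(* [e i j] witnesses [~ S (f i) (f j)]; [p i] below combines these witnesses so
   that it holds at [f i] and no point of [p i] is or sees a point of [p j]. *)
have exe i j : exists a, i < n.+1 -> j < n.+1 -> i != j ->
    sat (f j) a /\ ~ sat (f i) (D a).
  have [[ii [jj ij]]|h] := pselect (i < n.+1 /\ j < n.+1 /\ i != j).
    by have [a] := sepD _ _ (f_anti _ _ ii jj ij); exists a.
  by exists Top => ii jj ij; case: h.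
pose e i := projT1 (choice (exe i)).
have eP i j : i < n.+1 -> j < n.+1 -> i != j ->
    sat (f j) (e i j) /\ ~ sat (f i) (D (e i j)) := projT2 (choice (exe i)) j.
have exp i : exists a, i < n.+1 -> sat (f i) a /\
    forall v, sat v a -> forall j, j < n.+1 -> i != j ->
      sat v (e j i) /\ ~ sat v (D (e i j)).
  have [ii|nii] := pselect (i < n.+1); last by exists Top.
  have [j jj ij|a ia aP] := @finite_conj (f i)
      (fun j => And (e j i) (Neg (D (e i j)))) (fun j => i != j) n.+1.
    have [_ h] := eP _ _ ii jj ij.
    have ji : j != i by rewrite eq_sym.
    have [h' _] := eP _ _ jj ii ji.
    by apply/sat_and; split=> //; exact/sat_neg.
  exists a => _; split=> // v /aP va j jj ij.
  by have /sat_and[vj /sat_neg] := va _ jj ij.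
have [p pP] := choice exp.
have /sat_imp h : sat w (Imp (subst p _) (subst p _)) := wbw p.
have {h} : sat w (subst p (\big[Or/Bot]_(i < n.+1)
    \big[Or/Bot]_(j < n.+1 | i != j) D (And (Var i) (Or (Var j) (D (Var j)))))).
  apply: h; apply/sat_big_and => i _ _; rewrite substD; apply/satD.
  by exists (f i); [exact: wf | have [] := pP _ (ltn_ord i)].
move=> /sat_big_or[i [_ _ /sat_big_or[j [_ ij]]]].
rewrite substD => /satD[v _].
rewrite [subst _ _]/(And (p i) (Or (p j) (subst p (D (Var j))))) substD /=.
move=> /sat_and[vi vj].
(* At [v], [p i] excludes [D (e i j)], but [p j] at [v] or at a point seen from [v] provides it. *)
have [_ h] := pP _ (ltn_ord i); have [_] := h _ vi _ (ltn_ord j) ij.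
have [_ {}h] := pP _ (ltn_ord j).
have ji : j != i :> nat by rewrite eq_sym.
apply; apply/satD; case/sat_or: vj => [vj|/satD[u vu uj]].
  by exists v => //; have [] := h _ vj _ (ltn_ord i) ji.
by exists u => //; have [] := h _ uj _ (ltn_ord i) ji.
Qed.

(** Lets the variable [j.+1] be reassigned without disturbing [bd_succ j]. *)
Lemma eq_subst_bd j s s' : (forall i, i <= j -> s i = s' i) ->
  subst s (bd_succ j) = subst s' (bd_succ j).
Proof.
elim: j => [|j IH] ss' /=; first by rewrite ss'.
by rewrite ss' // IH // => i ij; apply: ss'; exact: leqW.
Qed.

(** For the first step from [x] to [y], tightness gives [a] with [Box a] at [y] and [a] false at
    [x]. This interprets the last variable; the chain from [y] refutes the rest. *)
Lemma chain_refutes_bd j x :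
  chain R setT j.+1 x -> exists s, ~ sat x (subst s (bd_succ j)).
Proof.
elim: j x => [|j IH] x [_ [y [xy /tight[a ya nxa]]]].
  move=> _; exists (fun=> a) => /= /sat_imp h; apply/nxa/h/sat_dia.
  by exists y.
move=> /IH[s nys].
pose s' i := if i == j.+1 then a else s i.
have s'j : s' j.+1 = a by rewrite /s' eqxx.
have ss' : subst s' (bd_succ j) = subst s (bd_succ j).
  by apply: eq_subst_bd => i ij; rewrite /s' ltn_eqF.
exists s' => h; apply: nxa; rewrite -s'j; move: h => /sat_imp; apply.
apply/sat_dia; exists y => //; apply/sat_and; split; first by rewrite /= s'j.
by apply/sat_neg; rewrite -ss' in nys.
Qed.

(** * Reflexive transitive models: balls and clusters *)

Hypothesis sat_S4 : forall w a,
  sat w (Imp (Box a) a) /\ sat w (Imp (Box a) (Box (Box a))).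

Lemma acc_refl w : R w w.
Proof.
apply: contrapT => /tight[a wBa]; apply.
by have [/sat_imp/(_ wBa)] := sat_S4 w a.
Qed.

Lemma acc_trans u v w : R u v -> R v w -> R u w.
Proof.
move=> uv vw; apply: contrapT => /tight[a ua]; apply.
have [_ /sat_imp/(_ ua)/sat_box/(_ _ uv)/sat_box] := sat_S4 u a.
exact.
Qed.

Definition neighbour (x y : W) : Prop := R x y \/ R y x.

Fixpoint ball (j : nat) (x : W) : set W :=
  match j with
  | 0 => [set x]
  | i.+1 => \bigcup_(y in neighbour x) ball i y
  end.

Lemma ball_center j x : ball j x x.
Proof. by elim: j => // j IH; exists x => //; left; exact: acc_refl. Qed.

Lemma ball_neighbour j x y z : ball j x y -> neighbour y z -> ball j.+1 x z.
Proof.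
elim: j x => [x -> yz|j IH x [u xu uy] yz]; first by exists z.
by exists u => //; exact: IH.
Qed.

Lemma finite_ball j x :
  (forall y, finite_set (neighbour y)) -> finite_set (ball j x).
Proof.
move=> fin; elim: j x => [|j IH] x; first exact: finite_set1.
exact: bigcup_finite.
Qed.

Lemma sat_delta x a : sat x (Delta a) <-> exists2 y, neighbour x y & sat y a.
Proof.
rewrite !sat_or sat_dia sat_past; split=> [[xa|[[y xy ya]|[y yx ya]]]|].
- by exists x => //; left; exact: acc_refl.
- by exists y => //; left.
- by exists y => //; right.
- by move=> [y [xy|yx] ya]; right; [left | right]; exists y.
Qed.

Lemma sat_iter_delta j x a :
  sat x (iter j Delta a) <-> exists2 y, ball j x y & sat y a.
Proof.
elim: j x => [|j IH] x /=; first by split=> [xa|[y ->]//]; exists x.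
rewrite sat_delta; split=> [[y xy /IH[z yz za]]|[z [y xy yz] za]].
  by exists z => //; exists y.
by exists y => //; apply/IH; exists z.
Qed.

Lemma subst_iter_delta s j a :
  subst s (iter j Delta a) = iter j Delta (subst s a).
Proof. by elim: j => //= j ->. Qed.

(** A neighbour [z] outside the finite ball satisfies some [d] false throughout the ball; then [d]
    is reached in [l.+1] steps but not in [l]. *)
Lemma bz_ball_closed l w : (forall s, sat w (subst s (bz l))) ->
  finite_set (ball l w) ->
  forall y z, ball l w y -> neighbour y z -> ball l w z.
Proof.
move=> wbz /finite_seqP[t tE] y z ly yz; apply: contrapT.
rewrite [X in ~ X z]tE => /negP/separate_seq[d zd td].
have /sat_imp : sat w (Imp (subst (fun=> d) (iter l.+1 Delta (Var 0)))
    (subst (fun=> d) (iter l Delta (Var 0)))) := wbz (fun=> d).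
rewrite !subst_iter_delta !sat_iter_delta => h.
have [|u] := h; first by exists z => //; exact: ball_neighbour yz.
by rewrite [X in X u]tE => /td.
Qed.

(** By transitivity both points see, and are seen by, the same points, so they agree on [Box] and
    [Past] formulas outright. *)
Lemma cluster_eq x y : cluster R x y ->
  (forall i, sat x (Var i) <-> sat y (Var i)) -> x = y.
Proof.
move=> [xy yx] vxy; apply: contrapT => /differentiated[a].
suff -> : sat x a <-> sat y a by [].
elim: a => [i||a IHa b IHb|a _|a _].
- exact: vxy.
- by split=> /sat_bot.
- by rewrite !sat_imp IHa IHb.
- rewrite !sat_box.
  by split=> h v; [move/(acc_trans xy) | move/(acc_trans yx)]; exact: h.
- rewrite !sat_past; split=> -[v vx va]; exists v => //.
    exact: acc_trans xy.
  exact: acc_trans yx.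
Qed.

(** * Finitely many variables: finite clusters and neighbourhoods *)

Variable q : nat.
Hypothesis sat_var : forall w i, q <= i -> ~ sat w (Var i).

Lemma finite_cluster x : finite_set (cluster R x).
Proof.
pose f y := [ffun i : 'I_q => `[< sat y (Var i) >]].
have f_inj : {in cluster R x &, injective f}.
  move=> y z /set_mem[xy yx] /set_mem[xz zx] /ffunP fyz.
  apply: cluster_eq => [|i].
    by split; [exact: acc_trans xz | exact: acc_trans xy].
  have [iq|qi] := ltnP i q; last by split=> /sat_var; case/(_ qi).
  have := fyz (Ordinal iq); rewrite !ffunE /= => e.
  by split=> h; apply/asboolP; [rewrite -e | rewrite e]; apply/asboolP.
by rewrite -(eq_finite_set (inj_card_eq f_inj)).
Qed.

Lemma finite_neighbours k n m w :
  (forall s v, sat v (subst s (bd_succ k))) ->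
  (forall s v, sat v (subst s (bw_fut n))) ->
  (forall s v, sat v (subst s (bw_past m))) ->
  finite_set (neighbour w).
Proof.
move=> wbd wfut wpast.
have nochain A x : ~ chain R A k.+1 x.
  move=> /(sub_chain (@subsetT _ A))/chain_refutes_bd[s]; exact.
have fincl := finite_cluster.
have fin A j : (forall f, ~ antichain R A j f) -> finite_set A.
  exact: finite_no_chain_antichain fincl (nochain A).
rewrite (_ : neighbour w = [set v | R w v] `|` [set v | R v w]) //.
rewrite finite_setU; split; [apply: (fin _ n.+1) | apply: (fin _ m.+1)] => f.
  apply: bw_antichain (wfut ^~ w) _ => //; first exact: sat_dia.
    move=> u v /tight[a ua nva]; exists (Neg a); first exact/sat_neg.
    by move=> /sat_dia[x ux /sat_neg]; apply; exact: (sat_box _ _).1 ua _ ux.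
  exact: acc_refl.
move=> [wf f_anti].
apply: (bw_antichain (S := fun x y => R y x) _ _ _ _ (wpast ^~ w)) => //.
(* For the past the separating formula is [Box a] itself: [Past (Box a)] at [u] would force [a]
   there. *)
- move=> u v /tight[a va nua]; exists (Box a) => //.
  by rewrite sat_past => -[x xu /sat_box/(_ _ xu)].
- exact: acc_refl.
- split=> [|i i' ii ii' ne]; first exact: wf.
  by apply: f_anti; rewrite // eq_sym.
Qed.

End Model.

(** * Substitutions and finite countermodels *)

Lemma subst_Var a : subst Var a = a.
Proof. by elim: a => //= [a -> b ->|a ->|a ->]. Qed.

Lemma subst_subst s s' a :
  subst s (subst s' a) = subst (fun i => subst s (s' i)) a.
Proof. by elim: a => //= [a -> b ->|a ->|a ->]. Qed.

Lemma subst_bounded a :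
  exists q, forall s, (forall i, i < q -> s i = Var i) -> subst s a = a.
Proof.
elim: a => [i||a [p pa] b [r rb]|a [p pa]|a [p pa]].
- by exists i.+1 => s; apply.
- by exists 0.
- exists (maxn p r) => s sV /=.
  rewrite pa ?rb // => i ir; apply: sV; rewrite leq_max ir ?orbT //.
- by exists p => s sV /=; rewrite pa.
- by exists p => s sV /=; rewrite pa.
Qed.

Lemma S4BP_finite_countermodel k l n m L a :
  tense_logic L -> S4BP k l n m `<=` L -> ~ L a ->
  exists2 F, L `<=` Log F & ~ Log F a.
Proof.
move=> hL hext nLa.
have [q qa] := subst_bounded a.
(* [L'] is the logic [L] with the variables from [q] on replaced by [Bot]; its
   canonical model is the [q]-variable one, but in the full language. *)
pose sg i := if i < q then Var i else Bot.
pose L' : set form := [set b | L (subst sg b)].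
have sga : subst sg a = a by apply: qa => i; rewrite /sg => ->.
have L'_taut : tautology `<=` L'.
  by move=> b tb; apply: (tl_subst hL); exact: (tl_taut hL).
have L'_mp b c : L' b -> L' (Imp b c) -> L' c by exact: (tl_mp hL).
have L'_adj b c : L' (Imp (Past b) c) <-> L' (Imp b (Box c)).
  exact: (tl_adj hL).
(* [L'] is not closed under substitution, but it contains every instance of a formula of [L]; this
   makes all instances true in its canonical model. *)
have L'sub s b : L b -> L' (subst s b).
  by move=> Lb; rewrite /L' /= subst_subst; exact: (tl_subst hL).
have thL' : theory L' L' by split.
(* Since [sg] fixes [a], [L'] omits [a] as well and is consistent with [Neg a]. *)
have [|u mu nau] := lindenbaum L'_taut (theory_imp L'_taut (Neg a) thL').
  move=> /= L'a; apply: nLa; rewrite -sga.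
  by apply: L'_mp L'a _; apply: L'_taut; taut.
pose W : choiceType := {classic canon L'}.
pose R : W -> W -> Prop := @canon_acc L'.
pose sat : W -> form -> Prop := @canon_sat L'.
have sat_bot w : ~ sat w Bot by have [] := svalP w.
have sat_imp w b c : sat w (Imp b c) <-> (sat w b -> sat w c).
  exact: max_theory_imp L'_taut _ (svalP w) b c.
have sat_box w b : sat w (Box b) <-> forall v, R w v -> sat v b.
  exact: canon_sat_box.
have sat_past w b : sat w (Past b) <-> exists2 v, R v w & sat v b.
  exact: canon_sat_past.
have tight v w : ~ R v w -> exists2 b, sat v (Box b) & ~ sat w b.
  exact: canon_tight.
have diff v w : v <> w -> exists2 b, sat v b & ~ sat w b.
  exact: canon_differentiated.
have satL' w b : L' b -> sat w b by exact: max_theoryL (svalP w) b.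
have satL b s w : L b -> sat w (subst s b) by move=> /L'sub/satL'.
have satS4t b s w : S4t b -> sat w (subst s b).
  by move=> Lb; apply: satL; apply: hext; apply: sub_gen_smallest; left.
have sat_S4 w b : sat w (Imp (Box b) b) /\ sat w (Imp (Box b) (Box (Box b))).
  split.
    apply: (satS4t (Imp (Box (Var 0)) (Var 0)) (fun=> b)).
    by apply: sub_gen_smallest; right; left.
  apply: (satS4t (Imp (Box (Var 0)) (Box (Box (Var 0)))) (fun=> b)).
  by apply: sub_gen_smallest; right; right.
have satax b s w : [set bd k; bz l; bw_fut n; bw_past m] b -> sat w (subst s b).
  by move=> axb; apply: satL; apply: hext; apply: sub_gen_smallest; right.
have sat_var w i : q <= i -> ~ sat w (Var i).
  move=> qi /=; apply/(sat_neg sat_bot sat_imp)/satL'.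
  by rewrite /L' /= /sg ltnNge qi; apply: (tl_taut hL); taut.
have fin w : finite_set (neighbour R w).
  apply: (@finite_neighbours W R sat sat_bot sat_imp sat_box sat_past tight diff
    sat_S4 q sat_var k.-1 n m) => s v; apply: satax.
  - by left; left; left.
  - by left; right.
  - by right.
pose w0 : W := exist _ u mu.
have [|||F LF Fw0] := @finite_generated_frame W R sat sat_bot sat_imp sat_box
    sat_past diff L (ball R l w0) w0 satL.
- exact: finite_ball.
- exact: ball_center tight sat_S4 _ _.
- apply: bz_ball_closed => //.
  + by move=> s; apply: satax; left; left; right.
  + exact: finite_ball.
exists F => // /Fw0; rewrite subst_Var /sat /canon_sat /= => ua.
have /(max_theory_neg L'_taut mu) : u (Neg a) by apply/nau/L'_taut; taut.
by [].
Qed.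

Theorem theorem5p19 (k l n m : nat) (hk : 0 < k) (hl : 0 < l) (hn : 0 < n)
    (hm : 0 < m) (L : set form) (hL : tense_logic L)
    (hext : S4BP k l n m `<=` L) (hpre : pretabular L) :
  fmp L.
Proof.
(* The class of all finite [L]-frames. *)
exists (fun F => L `<=` Log F); apply/seteqP; split=> [a La F|a La]; first exact.
apply: contrapT => nLa.
have [F LF] := S4BP_finite_countermodel hL hext nLa; apply; exact: La.
Qed.
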